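(* Let $u^{CD}$, $u^{FEM}$, $u^{HiDeNN-PGD}$, $u^{HiDeNN}$, $u^{NN}$ be minimizers of the energy potential $\Pi$ over $\mathcal{M}^h_{0,Q}$, $\mathcal{V}^h_0$, $\mathcal{G}^h_{0,Q}$, $\mathcal{H}^h_0$, $\mathcal{N}^h_0$, respectively, and let $u^{exact}=\arg\min_{u\in H^1_0(\Omega)}\Pi[u]$. Then for every number of modes $Q$, $$\| u^{CD}-u^{exact}\|_{E} \geq \| u^{FEM}-u^{exact}\|_{E} \geq \| u^{HiDeNN}-u^{exact}\|_{E} \geq \| u^{NN}-u^{exact}\|_{E}.$$ Moreover, if $Q$ is big enough, namely $Q\geq\min\{n_1,n_2\}$ in 2D or $Q\geq\min\{n_1n_2,\,n_2n_3,\,n_3n_1\}$ in 3D, then $$\| u^{CD}-u^{exact}\|_{E} \geq \| u^{FEM}-u^{exact}\|_{E} \geq \| u^{HiDeNN-PGD}-u^{exact}\|_{E}\geq \| u^{HiDeNN}-u^{exact}\|_{E} \geq \| u^{NN}-u^{exact}\|_{E}.$$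
   Context: Problem. Let $d\in\{2,3\}$ and let $\Omega\subset\mathbb{R}^d$ be a box (product of $d$ compact intervals). Consider $\mathcal{L}u+b=0$ in $\Omega$, $u|_{\partial\Omega}=0$, for a scalar function $u$, where $\mathcal{L}$ is a second-order differential operator and $b$ a source term. It is assumed that the problem has an energy potential $\Pi[u]=\tfrac12 a(u,u)-(b,u)$ with $(b,u)=\int_\Omega b\,u\,d\boldsymbol{x}$, where $a(\cdot,\cdot)$ is the symmetric bilinear form on $H_0^1(\Omega)$ corresponding to $\mathcal{L}$, positive definite so that $\|v\|_E=\sqrt{a(v,v)}$ is a norm (the energy norm); e.g. $a(f,g)=\int_\Omega\nabla f\cdot\nabla g\,d\boldsymbol{x}$ for the Poisson equation. All minimizers named in the claim are assumed to exist. Regular mesh. A fixed regular mesh is a product of 1D grids with $n_1,\dots,n_d$ nodes in the coordinate directions, the end nodes being the interval endpoints. In direction $k$, for any increasing node positions $\xi^{(k)}=(\xi^{(k)}_1<\dots<\xi^{(k)}_{n_k})$ with the same endpoints, let $N^{(k)}_I(\cdot\,;\xi^{(k)})$, $1\le I\le n_k$, be the 1D finite element shape functions on that grid (e.g. piecewise linear hat functions). The grid positions of the fixed mesh are denoted $\bar\xi^{(k)}$. Approximation sets. - $\mathcal{V}^h$ (FEM): the linear span of the products $\prod_{k=1}^d N^{(k)}_{I_k}(x_k;\bar\xi^{(k)})$. - $\mathcal{M}^h_Q$ (CD, canonical tensor decomposition with $Q$ modes): all functions $\sum_{q=1}^Q\prod_{k=1}^d X^{(q)}_k(x_k)$ with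 each $X^{(q)}_k$ in the linear span of $N^{(k)}_1(\cdot\,;\bar\xi^{(k)}),\dots,N^{(k)}_{n_k}(\cdot\,;\bar\xi^{(k)})$. - $\mathcal{G}^h_Q$ (HiDeNN-PGD): all functions of the same form as in $\mathcal{M}^h_Q$, but with the node positions $\xi^{(1)},\dots,\xi^{(d)}$ (common to all modes) also free, so that $X^{(q)}_k$ is in the linear span of the $N^{(k)}_I(\cdot\,;\xi^{(k)})$. - $\mathcal{H}^h$ (HiDeNN): all functions $\sum_{\mathcal{I}}\mathcal{N}_{\mathcal{I}}(\boldsymbol{x})\,\mathscr{u}_{\mathcal{I}}$, $\mathscr{u}_{\mathcal{I}}\in\mathbb{R}$, where $\mathcal{N}_{\mathcal{I}}$ are the finite element shape functions (written as neural network blocks) on a mesh with $n_1\cdots n_d$ nodes and the connectivity of the fixed mesh, whose nodal positions are free. When the nodes form a regular mesh with grid positions $\xi^{(1)},\dots,\xi^{(d)}$, these shape functions are the products $\prod_k N^{(k)}_{I_k}(x_k;\xi^{(k)})$. - $\mathcal{N}^h$ (NN): all functions realized by a neural network $\mathcal{F}^{NN}(\boldsymbol{x};\boldsymbol{W},\boldsymbol{b},\boldsymbol{\mathcal{A}})$ with activations $\boldsymbol{\mathcal{A}}$ and free real weights $\boldsymbol{W}$ and biases $\boldsymbol{b}$, where the network is assumed to have a more general structure than HiDeNN: every HiDeNN function is realized by the network for a particular choice of weights and biases, i.e. $\mathcal{H}^h\subset\mathcal{N}^h$. A subscript $0$ ($\mathcal{M}^h_{0,Q}$, $\mathcal{V}^h_0$,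 $\mathcal{G}^h_{0,Q}$, $\mathcal{H}^h_0$, $\mathcal{N}^h_0$) denotes the subset of functions satisfying the homogeneous boundary condition $u|_{\partial\Omega}=0$; these are all regarded as subsets of $H^1_0(\Omega)$. *)

(* Defs.v *)
From HB Require Import structures.
From mathcomp Require Import all_boot all_order all_algebra.
From mathcomp Require Import all_classical all_reals all_analysis.

Set Implicit Arguments.
Unset Strict Implicit.
Unset Printing Implicit Defensive.

Import Order.TTheory GRing.Theory Num.Theory.
Import numFieldNormedType.Exports.

Local Open Scope classical_set_scope.
Local Open Scope ring_scope.

(** [R^d] is ['rV[R]_d], with the product sigma-algebra, i.e. the smallest one
    for which the [d] coordinate functions are measurable. *)
Section measurable_rV.
Context {R : realType}.
Variable d : nat.

Let coord : 'I_d -> 'rV[R]_d -> R := fun i x => x ord0 i.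

Let rV_set0 : g_sigma_preimage coord set0.
Proof. exact: sigma_algebra0. Qed.

Let rV_setC A : g_sigma_preimage coord A -> g_sigma_preimage coord (~` A).
Proof. exact: sigma_algebraC. Qed.

Let rV_bigcup (F : (set 'rV[R]_d)^nat) :
  (forall i, g_sigma_preimage coord (F i)) ->
  g_sigma_preimage coord (\bigcup_i F i).
Proof. exact: sigma_algebra_bigcup. Qed.

HB.instance Definition _ := @isMeasurable.Build default_measure_display
  'rV[R]_d (g_sigma_preimage coord) rV_set0 rV_setC rV_bigcup.

End measurable_rV.

Section lebesgue_rV.
Context {R : realType}.

Definition cons_rV d (p : R * 'rV[R]_d) : 'rV[R]_d.+1 :=
  \row_(i < d.+1) oapp (p.2 ord0) p.1 (unlift ord0 i).

Lemma measurable_coord_rV d (i : 'I_d) :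
  measurable_fun [set: 'rV[R]_d] (fun x => x ord0 i).
Proof.
move=> _ Y mY; rewrite setTI; apply: sub_sigma_algebra => /=.
rewrite -bigcup_seq/=; exists i => /=; first by rewrite mem_index_enum.
by exists Y => //; rewrite setTI.
Qed.

Lemma measurable_fun_rVP d dT (T : measurableType dT) (f : T -> 'rV[R]_d) :
  (forall i, measurable_fun [set: T] (fun x => f x ord0 i)) ->
  measurable_fun [set: T] f.
Proof.
move=> mf _ A mA; rewrite setTI.
have : g_sigma_preimage (fun (i : 'I_d) (x : 'rV[R]_d) => x ord0 i) `<=`
    [set B | measurable (f @^-1` B)].
  apply: smallest_sub.
    split => /=.
    - by rewrite preimage_set0.
    - by move=> B mB; rewrite setTD preimage_setC; exact: measurableC.
    - by move=> F mF; rewrite preimage_bigcup; exact: bigcup_measurable.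
  rewrite -bigcup_seq; apply: bigcup_sub => i _ B [C mC <-] /=.
  by have := mf i measurableT C mC; rewrite !setTI -comp_preimage.
exact.
Qed.

Lemma measurable_cons_rV d : measurable_fun [set: R * 'rV[R]_d] (@cons_rV d).
Proof.
apply: measurable_fun_rVP => i.
under eq_fun do rewrite mxE.
case: (unlift ord0 i) => [j|] /=.
  apply: (measurableT_comp (f := fun x : 'rV[R]_d => x ord0 j)) => //.
  exact: measurable_coord_rV.
exact: measurable_fst.
Qed.

Section step.
Variables (d : nat) (mu : {measure set 'rV[R]_d -> \bar R}).

Definition lebesgue_rV_step : set 'rV[R]_d.+1 -> \bar R :=
  pushforward (@lebesgue_measure R \x^ mu)%E (@cons_rV d).

Let step0 : lebesgue_rV_step set0 = 0%E.
Proof. by rewrite /lebesgue_rV_step /pushforward preimage_set0 measure0. Qed.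

Let step_ge0 A : (0 <= lebesgue_rV_step A)%E.
Proof.
exact: (measure_ge0 (@lebesgue_measure R \x^ mu)%E (@cons_rV d @^-1` A)).
Qed.

Let step_sigma_additive : semi_sigma_additive lebesgue_rV_step.
Proof.
move=> F mF tF mUF; rewrite /lebesgue_rV_step /pushforward preimage_bigcup.
have mcons A : measurable A -> measurable (@cons_rV d @^-1` A).
  by move=> mA; rewrite -[X in measurable X]setTI; exact: measurable_cons_rV.
apply: measure_semi_sigma_additive.
- by move=> n; exact: mcons.
- apply/trivIsetP => /= i j _ _ ij; rewrite -preimage_setI.
  by move/trivIsetP : tF => /(_ _ _ _ _ ij) ->//; rewrite preimage_set0.
- by rewrite -preimage_bigcup; exact: mcons.
Qed.

HB.instance Definition _ := isMeasure.Build _ _ _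
  lebesgue_rV_step step0 step_ge0 step_sigma_additive.

End step.

Fixpoint lebesgue_rV (d : nat) : {measure set 'rV[R]_d -> \bar R} :=
  if d is d'.+1 then lebesgue_rV_step (lebesgue_rV d')
  else dirac (0 : 'rV[R]_0).

Lemma lebesgue_rV_prod d (A : 'I_d -> set R) :
  (forall i, measurable (A i)) ->
  lebesgue_rV d [set x : 'rV[R]_d | forall i, A i (x ord0 i)] =
  (\prod_(i < d) lebesgue_measure (A i))%E.
Proof.
elim: d A => [|d IH] A mA.
  by rewrite big_ord0 /= diracE mem_set //= => -[].
rewrite big_ord_recl -IH //.
have -> : lebesgue_rV d.+1 [set x : 'rV[R]_d.+1 | forall i, A i (x ord0 i)] =
    (lebesgue_measure \x^ lebesgue_rV d)%E
      (A ord0 `*`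
       [set x : 'rV[R]_d | forall i, A (lift ord0 i) (x ord0 i)]).
  congr ((_ \x^ _)%E _); apply/seteqP; split => -[t x] /=.
    move=> h; split; first by have := h ord0; rewrite mxE unlift_none.
    by move=> i; have := h (lift ord0 i); rewrite mxE liftK.
  move=> [h0 h] i; rewrite mxE; case: unliftP => [j ->|->] //=.
suff mB : measurable
    [set x : 'rV[R]_d | forall i, A (lift ord0 i) (x ord0 i)].
  by rewrite product_measure2E => //; exact: mA.
rewrite (_ : [set x | _] = \bigcap_(i in [set: 'I_d])
    ((fun x : 'rV[R]_d => x ord0 i) @^-1` A (lift ord0 i))).
  apply: fin_bigcap_measurable => // i _.
  by rewrite -[X in measurable X]setTI; exact: measurable_coord_rV.
by apply/seteqP; split => x /= h i; [move=> _|]; exact: (h i).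
Qed.

End lebesgue_rV.

(** Elements of the function spaces are represented by functions on the whole
    of [R^d]; their values outside the domain [Om] are irrelevant. *)
Section sobolev.
Context {R : realType} {d : nat}.
Implicit Types (Om : set 'rV[R]_d) (u v : 'rV[R]_d -> R).
Implicit Types Du Dv : 'I_d -> 'rV[R]_d -> R.

Definition box (lo hi : 'rV[R]_d) : set 'rV[R]_d :=
  [set x | forall k, lo ord0 k <= x ord0 k <= hi ord0 k].

Definition boundary Om : set 'rV[R]_d := closure Om `\` Om°.

Definition partial (i : 'I_d) u : 'rV[R]_d -> R := 'D_(delta_mx ord0 i) u.

Definition smooth u : Prop :=
  forall s : seq 'I_d,
    continuous (foldr partial u s : 'rV[R]_d -> R) /\
    forall i x, derivable (foldr partial u s : 'rV[R]_d -> R) x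
                  (delta_mx ord0 i).

Definition test_function Om (phi : 'rV[R]_d -> R) : Prop :=
  smooth phi /\
  exists2 K : set 'rV[R]_d, compact K /\ K `<=` Om° &
    forall x, ~ K x -> phi x = 0.

Definition L2 Om u : Prop :=
  measurable_fun Om u /\
  (lebesgue_rV d).-integrable Om (fun x => (u x ^+ 2)%:E).

Definition weak_gradient Om u Du : Prop :=
  forall phi, test_function Om phi -> forall i,
    \int[lebesgue_rV d]_(x in Om) (u x * partial i phi x) =
    - \int[lebesgue_rV d]_(x in Om) (Du i x * phi x).

Definition H1 Om u Du : Prop :=
  [/\ L2 Om u, forall i, L2 Om (Du i) & weak_gradient Om u Du].

Definition H1_sqdist Om (phi : 'rV[R]_d -> R) u Du : \bar R :=
  (\int[lebesgue_rV d]_(x in Om) ((phi x - u x) ^+ 2)%:E +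
   \sum_(i < d)
     \int[lebesgue_rV d]_(x in Om) ((partial i phi x - Du i x) ^+ 2)%:E)%E.

(** [H^1_0(Om)] is the closure of the test functions in [H^1(Om)]. *)
Definition H10 Om : set ('rV[R]_d -> R) :=
  [set u | exists2 Du, H1 Om u Du &
    exists2 phi : nat -> 'rV[R]_d -> R, forall m, test_function Om (phi m) &
      (fun m => H1_sqdist Om (phi m) u Du) @ \oo --> 0%E].

(** The scalar second-order operator
      [L u = sum_j d_j (sum_i A_ij d_i u + gamma_j u) + sum_i beta_i d_i u + c u]
    given by its coefficient functions. *)
Record diff_op := DiffOp {
  op_A : 'I_d -> 'I_d -> 'rV[R]_d -> R;
  op_gamma : 'I_d -> 'rV[R]_d -> R;
  op_beta : 'I_d -> 'rV[R]_d -> R;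
  op_c : 'rV[R]_d -> R }.

(** Integrand of [- (L u, v)] after one integration by parts. *)
Definition weak_integrand (L : diff_op) u Du v Dv (x : 'rV[R]_d) : R :=
  \sum_(j < d)
    (\sum_(i < d) op_A L i j x * Du i x + op_gamma L j x * u x) * Dv j x
  - (\sum_(i < d) op_beta L i x * Du i x + op_c L x * u x) * v x.

Implicit Type a : ('rV[R]_d -> R) -> ('rV[R]_d -> R) -> R.

Definition form_of_operator Om (L : diff_op) a : Prop :=
  forall u Du v Dv, H10 Om u -> H1 Om u Du -> H10 Om v -> H1 Om v Dv ->
    (lebesgue_rV d).-integrable Om (EFin \o weak_integrand L u Du v Dv) /\
    a u v = \int[lebesgue_rV d]_(x in Om) weak_integrand L u Du v Dv x.

Definition symmetric_on_H10 Om a : Prop :=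
  forall u v, H10 Om u -> H10 Om v -> a u v = a v u.

Definition bilinear_on_H10 Om a : Prop :=
  (forall (t : R) u v w, H10 Om u -> H10 Om v -> H10 Om w ->
    a (fun x => t * u x + v x) w = t * a u w + a v w) /\
  (forall (t : R) u v w, H10 Om u -> H10 Om v -> H10 Om w ->
    a w (fun x => t * u x + v x) = t * a w u + a w v).

(** Definiteness is up to null sets, functions being representatives. *)
Definition positive_definite_on_H10 Om a : Prop :=
  forall u, H10 Om u ->
    0 <= a u u /\
    (a u u = 0 -> {ae lebesgue_rV d, forall x, Om x -> u x = 0}).

Definition source_term Om (b : 'rV[R]_d -> R) : Prop :=
  forall u, H10 Om u ->
    (lebesgue_rV d).-integrable Om (fun x => (b x * u x)%:E).

Definition energy Om a (b u : 'rV[R]_d -> R) : R :=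
  2^-1 * a u u - \int[lebesgue_rV d]_(x in Om) (b x * u x).

Definition energy_norm a (v : 'rV[R]_d -> R) : R := Num.sqrt (a v v).

Definition is_minimizer (P : ('rV[R]_d -> R) -> R) (S : set ('rV[R]_d -> R))
    (u : 'rV[R]_d -> R) : Prop :=
  S u /\ forall v, S v -> P u <= P v.

Definition zero_trace Om (S : set ('rV[R]_d -> R)) : set ('rV[R]_d -> R) :=
  [set u | S u /\ forall x, boundary Om x -> u x = 0].

End sobolev.
Arguments diff_op : clear implicits.

Section grid.
Context {R : realType}.

Definition is_grid (lo hi : R) (m : nat) (xi : 'I_m -> R) : Prop :=
  [/\ forall I J : 'I_m, (I < J)%N -> xi I < xi J,
      forall I : 'I_m, I = 0%N :> nat -> xi I = lo &
      forall I : 'I_m, I.+1 = m -> xi I = hi].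

(** On every grid, the shape functions interpolate the nodal values and are
    polynomial on each closed cell (so in particular they are continuous). *)
Definition fe_shape_1d (lo hi : R) (m : nat)
    (N : ('I_m -> R) -> 'I_m -> R -> R) : Prop :=
  forall xi, is_grid lo hi xi -> forall I : 'I_m,
    (forall J, N xi I (xi J) = (I == J)%:R) /\
    (forall J K : 'I_m, K = J.+1 :> nat -> exists p : {poly R},
       forall t, xi J <= t <= xi K -> N xi I t = p.[t]).

End grid.

(** All of these are sets of functions on the box, so membership only
    constrains the values there. *)
Section approximation.
Context {R : realType} {d : nat}.
Variables (lo hi : 'rV[R]_d) (n : 'I_d -> nat).

Definition node : finType := {dffun forall k : 'I_d, 'I_(n k)}.

Definition grid_positions : Type := forall k : 'I_d, 'I_(n k) -> R.

Definition regular_grid (xi : grid_positions) : Prop :=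
  forall k, is_grid (lo ord0 k) (hi ord0 k) (xi k).

Definition shape_family : Type :=
  forall k : 'I_d, ('I_(n k) -> R) -> 'I_(n k) -> R -> R.

Variable N : shape_family.

Definition product_shape (xi : grid_positions) (I : node) (x : 'rV[R]_d) : R :=
  \prod_(k < d) N (xi k) (I k) (x ord0 k).

Definition FEM (xi : grid_positions) : set ('rV[R]_d -> R) :=
  [set u | exists c : node -> R, forall x, box lo hi x ->
     u x = \sum_(I : node) c I * product_shape xi I x].

Definition CD (xi : grid_positions) (Q : nat) : set ('rV[R]_d -> R) :=
  [set u | exists2 X : 'I_Q -> 'I_d -> R -> R,
     (forall q k, exists c : 'I_(n k) -> R,
        forall t, lo ord0 k <= t <= hi ord0 k ->
          X q k t = \sum_(I < n k) c I * N (xi k) I t) &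
     forall x, box lo hi x -> u x = \sum_(q < Q) \prod_(k < d) X q k (x ord0 k)].

Definition HiDeNN_PGD (Q : nat) : set ('rV[R]_d -> R) :=
  [set u | exists2 xi : grid_positions, regular_grid xi & CD xi Q u].

Definition regular_mesh (xi : grid_positions) : node -> 'rV[R]_d :=
  fun I => \row_(k < d) xi k (I k).

(** Finite elements whose nodal positions are a parameter: [mesh_region X e] is
    the subset of the box occupied by the element [e] and [mesh_shape X I] the
    shape function of the node [I] when the nodes sit at the positions [X]. The
    connectivity [mesh_conn], i.e. the set of nodes of each element, does not
    depend on the positions. *)
Record mesh_family := MeshFamily {
  mesh_elt : finType;
  mesh_conn : mesh_elt -> {set node};
  mesh_region : (node -> 'rV[R]_d) -> mesh_elt -> set 'rV[R]_d;
  mesh_shape : (node -> 'rV[R]_d) -> node -> 'rV[R]_d -> R }.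

(** The positions [X] are those of a mesh of the box with connectivity
    [mesh_conn]. *)
Definition is_mesh (M : mesh_family) (X : node -> 'rV[R]_d) : Prop :=
  [/\ injective X,
      forall e : mesh_elt M, closed (mesh_region X e),
      \bigcup_(e : mesh_elt M) mesh_region X e = box lo hi,
      forall e e' : mesh_elt M, e != e' ->
        (mesh_region X e)° `&` (mesh_region X e')° = set0 &
      forall (e : mesh_elt M) I, mesh_region X e (X I) <-> I \in mesh_conn e].

Definition is_fe_mesh_family (M : mesh_family) : Prop :=
  (forall X, is_mesh M X ->
    [/\ forall I J, mesh_shape M X I (X J) = (I == J)%:R,
        forall I, {within box lo hi, continuous (mesh_shape M X I)} &
        forall I (e : mesh_elt M) x, I \notin mesh_conn e ->
          mesh_region X e x -> mesh_shape M X I x = 0]) /\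
  (forall xi, regular_grid xi ->
    is_mesh M (regular_mesh xi) /\
    forall I x, box lo hi x ->
      mesh_shape M (regular_mesh xi) I x = product_shape xi I x).

Definition HiDeNN (M : mesh_family) : set ('rV[R]_d -> R) :=
  [set u | exists2 X, is_mesh M X &
     exists w : node -> R, forall x, box lo hi x ->
       u x = \sum_(I : node) mesh_shape M X I x * w I].

End approximation.

(** The condition is only meaningful for [d = 2] and [d = 3]. *)
Definition enough_modes (d : nat) : ('I_d -> nat) -> nat -> bool :=
  match d with
  | 2 => fun n Q =>
      let n1 := n (@Ordinal 2 0 isT) in
      let n2 := n (@Ordinal 2 1 isT) in
      (minn n1 n2 <= Q)%N
  | 3 => fun n Q =>
      let n1 := n (@Ordinal 3 0 isT) in
      let n2 := n (@Ordinal 3 1 isT) in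
      let n3 := n (@Ordinal 3 2 isT) in
      (minn (n1 * n2) (minn (n2 * n3) (n3 * n1)) <= Q)%N
  | _ => fun _ _ => false
  end.

Section network.
Context {R : realType}.

(** Architecture of a feed-forward network with scalar output: number of
    layers, their widths, and the activation of every neuron. *)
Inductive network : nat -> Type :=
| OutputLayer m (act : R -> R) : network m
| HiddenLayer m p (act : 'I_p -> R -> R) (rest : network p) : network m.

Fixpoint parameters m (net : network m) : Type :=
  match net with
  | OutputLayer m _ => ('cV[R]_m * R)%type
  | HiddenLayer m p _ rest => (('M[R]_(m, p) * 'rV[R]_p) * parameters rest)%type
  end.

Fixpoint realize m (net : network m) : parameters net -> 'rV[R]_m -> R :=
  match net return parameters net -> 'rV[R]_(_) -> R with
  | OutputLayer m act => fun W x => act ((x *m W.1) ord0 ord0 + W.2)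
  | HiddenLayer m p act rest => fun W x =>
      realize W.2 (\row_(j < p) act j ((x *m W.1.1 + W.1.2) ord0 j))
  end.

Definition NN d (lo hi : 'rV[R]_d) (net : network d) : set ('rV[R]_d -> R) :=
  [set u | exists W : parameters net, forall x, box lo hi x ->
     u x = realize W x].

End network.
Arguments network : clear implicits.

(* Main.v *)
Require Import Defs.
From mathcomp Require Import all_boot all_order all_algebra.
From mathcomp Require Import all_classical all_reals all_analysis.
From mathcomp Require Import measurable_realfun ring lra.
Import Order.TTheory GRing.Theory Num.Theory.
Import numFieldNormedType.Exports.
Local Open Scope classical_set_scope.
Local Open Scope ring_scope.

(* Since [H10] is a vector space, the first variation of the energy vanishes at
   [uexact], so [energy u - energy uexact] is half the squared energy norm of
   [u - uexact]. Minimizing over a larger subset of [H10] therefore cannot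
   increase the error, and the claim reduces to inclusions between the
   approximation sets. The only one that needs many modes, [FEM] in
   [HiDeNN_PGD], holds because a coefficient tensor is a sum of its fibres in
   one direction, each of which is a rank-one mode. *)

(** * Borel measurability on ['rV[R]_d], and boxes: finite measure and compactness *)

Section measurability_rV.
Context {R : realType} {d : nat}.

Lemma measurable_forall_coord (A : 'I_d -> set R) :
  (forall i, measurable (A i)) ->
  measurable [set x : 'rV[R]_d | forall i, A i (x ord0 i)].
Proof.
move=> mA; rewrite (_ : [set x | _] = \bigcap_(i in [set: 'I_d])
    ((fun x : 'rV[R]_d => x ord0 i) @^-1` A i)).
  apply: fin_bigcap_measurable => // i _.
  by rewrite -[X in measurable X]setTI; exact: measurable_coord_rV.
by apply/seteqP; split => x /= h i; [move=> _|]; exact: (h i).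
Qed.

(* An open set is the union of the countably many boxes with rational corners
   that it contains. *)
Lemma open_measurable_rV (U : set 'rV[R]_d) : open U -> measurable U.
Proof.
move=> oU.
pose B (p : 'rV[rat]_d * 'rV[rat]_d) : set 'rV[R]_d :=
  [set x | forall i,
     `](ratr (p.1 ord0 i)), (ratr (p.2 ord0 i))[%classic (x ord0 i)].
rewrite (_ : U = \bigcup_(p in [set p | B p `<=` U]) B p).
  rewrite bigcup_mkcond; apply: countable_bigcupT_measurable => [|p].
    exact: countableP.
  case: ifPn => // _.
  apply: (measurable_forall_coord (fun i =>
    `](ratr (p.1 ord0 i)), (ratr (p.2 ord0 i))[%classic)) => i.
  exact: measurable_itv.
apply/seteqP; split => [x Ux|x [p]]; last exact.
have /nbhs_ballP[e /= e0 eU] : nbhs x U by exact: open_nbhs_nbhs.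
(* The rational corners are taken within [e] of [x] on either side, so that the box they span lies
   in the sup-norm ball of radius [e] around [x]. *)
have /choice[p px] i : exists q : rat, x ord0 i - e < ratr q < x ord0 i.
  have /rat_in_itvoo[q] : x ord0 i - e < x ord0 i by rewrite ltrBlDr ltrDl.
  by rewrite in_itv /=; exists q.
have /choice[q qx] i : exists q : rat, x ord0 i < ratr q < x ord0 i + e.
  have /rat_in_itvoo[q] : x ord0 i < x ord0 i + e by rewrite ltrDl.
  by rewrite in_itv /=; exists q.
exists (\row_i p i, \row_i q i) => /= [y By|i]; last first.
  rewrite /= in_itv /= !mxE.
  by have /andP[_ ->] := px i; have /andP[-> _] := qx i.
apply: eU; split => // i j; rewrite (ord1 i) /ball /= ltr_distlC.
have := By j; rewrite /= in_itv /= !mxE => /andP[py yq].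
have /andP[px1 _] := px j; have /andP[_ qx2] := qx j.
by rewrite (lt_trans px1 py) (lt_trans yq qx2).
Qed.

Lemma continuous_measurable_rV (f : 'rV[R]_d -> R) :
  continuous f -> measurable_fun setT f.
Proof.
move=> /continuousP cf.
apply: (measurability _ (RGenOpens.measurableE R)) => //.
move=> _ [_ [x [y ->]] <-]; rewrite setTI; apply: open_measurable_rV.
exact/cf/interval_open.
Qed.

Lemma measurable_box (lo hi : 'rV[R]_d) : measurable (box lo hi).
Proof.
apply: (measurable_forall_coord (fun k => `[lo ord0 k, hi ord0 k]%classic)).
by move=> k; exact: measurable_itv.
Qed.
End measurability_rV.

Lemma box_set_itv {R : realType} d (lo hi : 'rV[R]_d) :
  box lo hi =
  [set x : 'rV[R]_d | forall k, `[lo ord0 k, hi ord0 k]%classic (x ord0 k)].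
Proof. by apply/seteqP; split => x h k; have := h k; rewrite /= in_itv. Qed.

Lemma lebesgue_box_lt_pinfty {R : realType} d (lo hi : 'rV[R]_d) :
  (lebesgue_rV d (box lo hi) < +oo)%E.
Proof.
(* Finiteness is restated as [fin_num], a property that passes to products. *)
rewrite -ge0_fin_numE ?measure_ge0 //.
rewrite box_set_itv.
rewrite (@lebesgue_rV_prod R d (fun k => `[lo ord0 k, hi ord0 k]%classic)) //.
elim/big_ind : _ => [//|x y|i _]; first exact: fin_numM.
by rewrite lebesgue_measure_itv /=; case: ifP.
Qed.

Lemma compact_box {R : realType} d (lo hi : 'rV[R]_d) : compact (box lo hi).
Proof.
rewrite box_set_itv.
apply: (@rV_compact R d (fun k => `[lo ord0 k, hi ord0 k]%classic)).
by move=> k; exact: segment_compact.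
Qed.

Lemma continuous_bounded_box {R : realType} d (lo hi : 'rV[R]_d)
    (f : 'rV[R]_d -> R) :
  continuous f -> [bounded f x | x in box lo hi].
Proof.
move=> cf.
have cfb : {within box lo hi, continuous f} := continuous_subspaceT cf.
have := compact_bounded (continuous_compact cfb (compact_box _ lo hi)).
move=> [M [Mreal fM]]; exists M; split=> // y My x xbox.
by apply: (fM y My); exists x.
Qed.

(** * Linear combinations of test functions and in [L2], [H1] and [H10] *)

Section linearity.
Context {R : realType} {d : nat}.
Implicit Types u v : 'rV[R]_d -> R.

Lemma partial_lin (t : R) u v i :
  (forall x, derivable u x (delta_mx ord0 i)) ->
  (forall x, derivable v x (delta_mx ord0 i)) ->
  partial i (fun x => t * u x + v x) =
    (fun x => t * partial i u x + partial i v x).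
Proof.
move=> du dv; apply/funext => x; rewrite /partial.
by rewrite (deriveD (f := t \*: u)) ?deriveZ //; exact: derivableZ.
Qed.

Lemma smooth_lin (t : R) u v :
  smooth u -> smooth v -> smooth (fun x => t * u x + v x).
Proof.
move=> su sv s.
have -> : foldr partial (fun x => t * u x + v x) s =
    (fun x => t * foldr partial u s x + foldr partial v s x).
  elim: s => //= i s ->; apply: partial_lin => x.
    by have [] := su s.
  by have [] := sv s.
have [[cu du] [cv dv]] := (su s, sv s); split => [x|i x].
  exact: (cvgD (cvgM (cvg_cst t) (cu x)) (cv x)).
by apply: (derivableD (f := t \*: _)) => //; exact: derivableZ.
Qed.

Lemma test_function_lin (Om : set 'rV[R]_d) (t : R) u v :
  test_function Om u -> test_function Om v ->
  test_function Om (fun x => t * u x + v x).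
Proof.
move=> [su [K [cK KO] uK]] [sv [K' [cK' KO'] vK']]; split.
  exact: smooth_lin.
exists (K `|` K'); first by split; [exact: compactU | rewrite subUset].
move=> x /not_orP[Kx K'x].
by rewrite uK // vK' // mulr0 addr0.
Qed.

Variables (lo hi : 'rV[R]_d).
Let Om := box lo hi.
Let mu := lebesgue_rV (R := R) d.
Let mOm : measurable Om := measurable_box lo hi.

(** A continuous function is bounded on the compact box, which has finite measure. This puts test
    functions and their partial derivatives in [L2]. *)
Lemma L2_continuous u : continuous u -> L2 Om u.
Proof.
move=> cu; split.
  by apply: measurable_funS (continuous_measurable_rV u cu).
have cu2 : continuous (fun x => u x ^+ 2).
  by move=> x; apply: (cvgM (cu x) (cu x)).
apply: measurable_bounded_integrable => //.
- exact: lebesgue_box_lt_pinfty.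
- by apply: measurable_funS (continuous_measurable_rV _ cu2).
- exact: continuous_bounded_box.
Qed.

(** The product is dominated by [u ^+ 2 + v ^+ 2]. *)
Lemma L2_mul_integrable u v :
  L2 Om u -> L2 Om v -> mu.-integrable Om (EFin \o (u \* v)).
Proof.
move=> [mu0 iu] [mv iv].
apply: (le_integrable mOm _ _ (integrableD mOm iu iv)).
  by apply/measurable_EFinP; exact: measurable_funM.
move=> x _ /=; rewrite lee_fin [X in _ <= X]ger0_norm; last first.
  by rewrite addr_ge0 ?sqr_ge0.
by rewrite ler_norml; nra.
Qed.

Lemma L2_lin (t : R) u v : L2 Om u -> L2 Om v -> L2 Om (fun x => t * u x + v x).
Proof.
move=> hu hv; have [[mu0 iu] [mv iv]] := (hu, hv).
have m : measurable_fun Om (fun x => t * u x + v x).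
  by apply: measurable_funD => //; exact: measurable_funM.
split => //.
have := integrableD mOm (integrableD mOm (integrableZl mOm (t ^+ 2) iu) iv)
  (integrableZl mOm (2 * t) (L2_mul_integrable _ _ hu hv)).
apply: eq_integrable => // x _ /=.
rewrite -!EFinM -!EFinD; congr EFin; ring.
Qed.

(** Real-valued integrals split over sums of integrable functions; here every product with [phi] or
    [partial i phi] is integrable because both factors are in [L2]. *)
Lemma weak_gradient_lin (t : R) u Du v Dv :
  H1 Om u Du -> H1 Om v Dv ->
  weak_gradient Om (fun x => t * u x + v x) (fun i x => t * Du i x + Dv i x).
Proof.
move=> [Lu LDu wu] [Lv LDv wv] phi tphi i.
have Lphi : L2 Om phi.
  by apply: L2_continuous; have [/(_ [::])[]] := tphi.
have LDphi : L2 Om (partial i phi).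
  by apply: L2_continuous; have [/(_ [:: i])[]] := tphi.
have lin f g h : L2 Om f -> L2 Om g -> L2 Om h ->
    \int[mu]_(x in Om) ((t * f x + g x) * h x) =
    t * \int[mu]_(x in Om) (f x * h x) + \int[mu]_(x in Om) (g x * h x).
  move=> Lf Lg Lh.
  under eq_Rintegral do rewrite mulrDl -mulrA.
  rewrite RintegralD //.
  - by rewrite RintegralZl //; exact: L2_mul_integrable.
  - by apply: (integrableZl mOm t (L2_mul_integrable _ _ Lf Lh)).
  - exact: L2_mul_integrable.
rewrite !lin // wu // wv //; ring.
Qed.

Lemma H1_lin (t : R) u Du v Dv :
  H1 Om u Du -> H1 Om v Dv ->
  H1 Om (fun x => t * u x + v x) (fun i x => t * Du i x + Dv i x).
Proof.
move=> hu hv; have [[Lu LDu _] [Lv LDv _]] := (hu, hv); split.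
- exact: L2_lin.
- by move=> i; exact: L2_lin.
- exact: weak_gradient_lin.
Qed.

(** Pointwise, the right-hand side exceeds the left-hand side by [(t * f x - g x) ^+ 2]. *)
Lemma integral_sqr_lin_le (t : R) f g :
  measurable_fun Om f -> measurable_fun Om g ->
  (\int[mu]_(x in Om) ((t * f x + g x) ^+ 2)%:E <=
   (2 * t ^+ 2)%:E * \int[mu]_(x in Om) (f x ^+ 2)%:E +
   2%:E * \int[mu]_(x in Om) (g x ^+ 2)%:E)%E.
Proof.
move=> mf mg.
have mf2 : measurable_fun Om (fun x => (f x ^+ 2)%:E).
  by apply/measurable_EFinP; exact: measurable_funX.
have mg2 : measurable_fun Om (fun x => (g x ^+ 2)%:E).
  by apply/measurable_EFinP; exact: measurable_funX.
have sq0 (h : 'rV[R]_d -> R) x : Om x -> (0 <= (h x ^+ 2)%:E)%E.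
  by rewrite lee_fin sqr_ge0.
have t0 : 0 <= 2 * t ^+ 2 by rewrite mulr_ge0 ?sqr_ge0.
rewrite -!ge0_integralZl //; try exact: sq0.
rewrite -ge0_integralD //.
- apply: ge0_le_integral => //.
  + by move=> x _; rewrite lee_fin sqr_ge0.
  + apply/measurable_EFinP; apply: measurable_funX.
    by apply: measurable_funD => //; exact: measurable_funM.
  + by apply: emeasurable_funD; exact: measurable_funeM.
  + move=> x _; rewrite -!EFinM -EFinD lee_fin.
    have := sqr_ge0 (t * f x - g x). nra.
- by move=> x Ox; rewrite mule_ge0 ?sq0.
- exact: measurable_funeM.
- by move=> x Ox; rewrite mule_ge0 ?sq0.
- exact: measurable_funeM.
Qed.

Lemma H1_sqdist_ge0 phi u Du : (0 <= H1_sqdist Om phi u Du)%E.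
Proof.
rewrite adde_ge0 ?sume_ge0 // => *; apply: integral_ge0 => *;
  by rewrite lee_fin sqr_ge0.
Qed.

(** Applying [integral_sqr_lin_le] to the function and to each partial derivative replaces a
    triangle inequality for the [H1] distance. *)
Lemma H1_sqdist_lin_le (t : R) phi psi u Du v Dv :
  test_function Om phi -> test_function Om psi -> H1 Om u Du -> H1 Om v Dv ->
  (H1_sqdist Om (fun x => t * phi x + psi x)%R
      (fun x => t * u x + v x)%R (fun i x => t * Du i x + Dv i x)%R <=
   (2 * t ^+ 2)%:E * H1_sqdist Om phi u Du + 2%:E * H1_sqdist Om psi v Dv)%E.
Proof.
move=> tphi tpsi [[mu0 _] LDu _] [[mv _] LDv _].
have mtest w : test_function Om w -> measurable_fun Om w.
  by move=> [/(_ [::])[cw _] _]; have [] := L2_continuous _ cw.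
have mdtest w i : test_function Om w -> measurable_fun Om (partial i w).
  by move=> [/(_ [:: i])[cw _] _]; have [] := L2_continuous _ cw.
rewrite /H1_sqdist.
have sq0 (h : 'rV[R]_d -> R) : (0 <= \int[mu]_(x in Om) (h x ^+ 2)%:E)%E.
  by apply: integral_ge0 => x _; rewrite lee_fin sqr_ge0.
have sqdist_le f g h k : measurable_fun Om f -> measurable_fun Om g ->
    measurable_fun Om h -> measurable_fun Om k ->
    (\int[mu]_(x in Om) ((t * f x + g x - (t * h x + k x)) ^+ 2)%:E <=
     (2 * t ^+ 2)%:E * \int[mu]_(x in Om) ((f x - h x) ^+ 2)%:E +
     2%:E * \int[mu]_(x in Om) ((g x - k x) ^+ 2)%:E)%E.
  move=> mf mg mh mk.
  under eq_integral do rewrite opprD addrACA -mulrBr.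
  exact: integral_sqr_lin_le (measurable_funB mf mh) (measurable_funB mg mk).
have t0 : 0 <= 2 * t ^+ 2 by rewrite mulr_ge0 ?sqr_ge0.
rewrite ge0_muleDr ?sume_ge0 // [X in (_ <= _ + X)%E]ge0_muleDr ?sume_ge0 //.
rewrite !ge0_sume_distrr // addeACA -big_split /=.
apply: leeD; first by apply: sqdist_le => //; exact: mtest.
apply: lee_sum => i _; rewrite partial_lin => [|x|x].
- by apply: sqdist_le; [exact: mdtest.. | have [] := LDu i | have [] := LDv i].
- by have [/(_ [::])[_]] := tphi.
- by have [/(_ [::])[_]] := tpsi.
Qed.

(** The same combination of the two approximating sequences works: its distance is squeezed between
    0 and the bound of [H1_sqdist_lin_le]. This makes variations around an element of [H10]
    admissible. *)
Lemma H10_lin (t : R) u v :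
  H10 Om u -> H10 Om v -> H10 Om (fun x => t * u x + v x).
Proof.
move=> [Du hu [phi tphi phiu]] [Dv hv [psi tpsi psiv]].
exists (fun i x => t * Du i x + Dv i x); first exact: H1_lin.
exists (fun m x => t * phi m x + psi m x).
  by move=> m; exact: test_function_lin.
pose bound m := ((2 * t ^+ 2)%:E * H1_sqdist Om (phi m) u Du +
  2%:E * H1_sqdist Om (psi m) v Dv)%E.
apply: (squeeze_cvge (f := fun=> 0%E) (h := bound)).
- by near=> m; rewrite H1_sqdist_ge0 /= H1_sqdist_lin_le.
- exact: cvg_cst.
(* The limit 0 is rewritten in the shape of [bound], with both distances replaced by their limit
   0. *)
- rewrite -[X in _ --> X](adde0 0%E) -[X in (X + _)%E](mule0 (2 * t ^+ 2)%:E).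
  rewrite -[X in (_ + X)%E](mule0 2%:E).
  by apply: cvgeD; [rewrite !mule0 | exact: cvgeZl..].
Unshelve. all: end_near. Qed.

End linearity.

(** * Energy excess as squared energy-norm error *)

Section energy.
Context {R : realType} {d : nat}.
Variables (lo hi : 'rV[R]_d).
Let Om := box lo hi.
Variables (a : ('rV[R]_d -> R) -> ('rV[R]_d -> R) -> R) (b : 'rV[R]_d -> R).
Hypothesis a_bil : bilinear_on_H10 Om a.
Hypothesis a_sym : symmetric_on_H10 Om a.
Hypothesis b_int : source_term Om b.

(** By bilinearity the energy is a quadratic polynomial in [t] along a line; symmetry merges the two
    cross terms, and the coefficient of [t] is the first variation. *)
Lemma energy_line (t : R) u w : H10 Om u -> H10 Om w ->
  energy Om a b (fun x => t * w x + u x) =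
  energy Om a b u + t * (a u w - \int[lebesgue_rV d]_(x in Om) (b x * w x))
  + 2^-1 * t ^+ 2 * a w w.
Proof.
move=> hu hw; have htw := H10_lin lo hi t w u hw hu.
have [al ar] := a_bil.
rewrite /energy al // !ar // (a_sym w u) //.
have -> : \int[lebesgue_rV d]_(x in Om) (b x * (t * w x + u x)) =
    t * \int[lebesgue_rV d]_(x in Om) (b x * w x) +
    \int[lebesgue_rV d]_(x in Om) (b x * u x).
  under eq_Rintegral do rewrite mulrDr mulrCA.
  rewrite RintegralD ?RintegralZl //; try exact: b_int;
    try exact: measurable_box.
  exact: (integrableZl (measurable_box lo hi) t (b_int _ hw)).
by field.
Qed.

(* The first variation vanishes at the minimizer, so the energy of [u] exceeds
   the minimum exactly by the second variation. *)
Lemma energy_minimizer u0 u :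
  is_minimizer (energy Om a b) (H10 Om) u0 -> H10 Om u ->
  energy Om a b u = energy Om a b u0 + 2^-1 * a (u \- u0) (u \- u0).
Proof.
move=> [hu0 min0] hu; set w := u \- u0.
have hw : H10 Om w.
  rewrite (_ : w = fun x => -1 * u0 x + u x); first exact: H10_lin.
  by apply/funext => x /=; rewrite mulN1r addrC.
have -> : u = (fun x => 1 * w x + u0 x).
  by apply/funext => x /=; rewrite mul1r subrK.
rewrite energy_line // expr1n mulr1 mul1r.
set g := a u0 w - _; set A := a w w.
suff -> : g = 0 by rewrite addr0.
have first_var t : 0 <= t * g + 2^-1 * t ^+ 2 * A.
  have := min0 _ (H10_lin lo hi t w u0 hw hu0).
  by rewrite energy_line // -addrA lerDl.
(* Adding the inequalities at [t = 1] and [t = -1] cancels [g]. *)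
have A0 : 0 <= A by have := first_var 1; have := first_var (-1); lra.
have A1 : 0 < A + 1 by rewrite ltr_wpDl.
(* A step against the sign of [g]. Dividing by [A + 1] instead of [A] covers the case [A = 0], and
   the resulting value is negative unless [g = 0]. *)
have := first_var (- g / (A + 1)).
have -> : - g / (A + 1) * g + 2^-1 * (- g / (A + 1)) ^+ 2 * A =
    - (g ^+ 2 * (2^-1 * A + 1) / (A + 1) ^+ 2) by field; rewrite gt_eqF.
rewrite oppr_ge0 => g2; apply/eqP; apply: contraTT g2 => g0.
rewrite -ltNge divr_gt0 ?exprn_gt0 // mulr_gt0 ?exprn_even_gt0 //.
by rewrite ltr_wpDl ?mulr_ge0.
Qed.

(** [S] and [T] are arbitrary sets because the approximation sets, such as those with free nodes,
    are in general not linear; only energies are compared. *)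
Lemma energy_norm_minimizer_le u0 (S T : set ('rV[R]_d -> R)) u v :
  is_minimizer (energy Om a b) (H10 Om) u0 ->
  S `<=` T -> T `<=` H10 Om ->
  is_minimizer (energy Om a b) S u -> is_minimizer (energy Om a b) T v ->
  energy_norm a (v \- u0) <= energy_norm a (u \- u0).
Proof.
move=> min0 ST TH [Su _] [Tv minv]; rewrite ler_wsqrtr //.
have := minv _ (ST _ Su); rewrite (energy_minimizer u0 v) //; last exact: TH.
rewrite (energy_minimizer u0 u) //; last exact/TH/ST.
by rewrite lerD2l ler_pM2l ?invr_gt0.
Qed.
End energy.

(** * Inclusions between the approximation sets *)

(** Distributivity with an index type depending on the factor, since the number of nodes depends on
    the direction. *)
Lemma prod_sum_dffun (R : comPzRingType) (I : finType) (T_ : I -> finType)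
    (F : forall i, T_ i -> R) :
  \prod_i \sum_(j : T_ i) F i j =
  \sum_(f : {dffun forall i, T_ i}) \prod_i F i (f i).
Proof.
pose G i : {ffun T_ i -> R} := [ffun j => F i j].
transitivity (\prod_i \sum_(j : T_ i) G i j).
  by apply: eq_bigr => i _; apply: eq_bigr => j _; rewrite ffunE.
(* The inner sums are moved to the common tagged type, where ordinary distributivity applies; the
   reindexing then returns to dependent functions. *)
under eq_bigr => i _ do rewrite (big_tag G i).
rewrite bigA_distr_big_dep -(big_fprod _ _ G).
rewrite (reindex (@fprod_of_dffun I T_)); last exact/onW_bij/fprod_of_dffun_bij.
apply: eq_bigr => f _; apply: eq_bigr => i _.
by rewrite fprodE ffunE.
Qed.

(** Each term of the minimum is the product over all directions but one, and [k0] is the direction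
    missing from a term that is at most [Q]. *)
Lemma enough_modes_fibre (d : nat) (n : 'I_d -> nat) (Q : nat) :
  enough_modes n Q -> exists k0 : 'I_d, (\prod_(k | k != k0) n k <= Q)%N.
Proof.
(* Expanding the product yields lifted ordinals, matched by value with the literals in
   [enough_modes]. *)
have reindex_le (i j : 'I_d) : i = j :> nat -> n i = n j.
  by move=> /val_inj ->.
case: d n reindex_le => [|[|[|[|d]]]] n ext //=; rewrite !geq_min.
- case/orP => nQ; [exists (@Ordinal 2 1 isT) | exists (@Ordinal 2 0 isT)];
    apply: leq_trans nQ; rewrite big_mkcond !big_ord_recl big_ord0 /=;
    by rewrite ?muln1 ?mul1n leq_eqVlt; apply/orP; left; apply/eqP/ext.
- case/or3P => nQ; [exists (@Ordinal 3 2 isT) | exists (@Ordinal 3 0 isT) |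
      exists (@Ordinal 3 1 isT)];
    apply: leq_trans nQ; rewrite big_mkcond !big_ord_recl big_ord0 /=;
    rewrite ?muln1 ?mul1n leq_eqVlt; apply/orP; left; apply/eqP;
    by [congr muln; exact: ext | rewrite mulnC; congr muln; exact: ext].
Qed.

Section approximation_sets.
Context {R : realType} {d : nat}.
Variables (lo hi : 'rV[R]_d) (n : 'I_d -> nat) (N : @shape_family R d n).
Implicit Type xi : @grid_positions R d n.

Lemma zero_trace_sub (Om : set 'rV[R]_d) S T :
  S `<=` T -> zero_trace Om S `<=` zero_trace Om T.
Proof. by move=> ST u [Su u0]; split => //; exact: ST. Qed.

(** Multiplying out each mode yields product shapes; the coefficient tensor is the sum over the
    modes of the products of their 1D coefficients. *)
Lemma CD_sub_FEM xi Q : CD lo hi N xi Q `<=` FEM lo hi N xi.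
Proof.
move=> u [X XN uX].
pose c q k := projT1 (cid (XN q k)); have cX q k := projT2 (cid (XN q k)).
exists (fun I : node n => \sum_(q < Q) \prod_(k < d) c q k (I k)) => x xbox.
rewrite uX //; under [RHS]eq_bigr do rewrite mulr_suml.
rewrite exchange_big; apply: eq_bigr => q _ /=.
under eq_bigr => k _ do rewrite (cX q k) ?xbox //.
rewrite prod_sum_dffun; apply: eq_bigr => I _.
by rewrite -big_split.
Qed.

Lemma FEM_sub_HiDeNN (M : @mesh_family R d n) xi :
  is_fe_mesh_family lo hi N M -> regular_grid lo hi xi ->
  FEM lo hi N xi `<=` HiDeNN lo hi M.
Proof.
move=> [_ /(_ xi)] hM /hM[mesh shape] u [c uc].
exists (regular_mesh xi) => //; exists c => x xbox.
by rewrite uc //; apply: eq_bigr => I _; rewrite shape // mulrC.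
Qed.

(** The function lies in the finite element space of its own grid, whose regular mesh is a position
    of the free nodes. *)
Lemma HiDeNN_PGD_sub_HiDeNN (M : @mesh_family R d n) Q :
  is_fe_mesh_family lo hi N M ->
  HiDeNN_PGD lo hi N Q `<=` HiDeNN lo hi M.
Proof. by move=> hM u [xi gxi /CD_sub_FEM]; exact: FEM_sub_HiDeNN. Qed.

(** [CD] asks for exactly [Q] modes, so a shorter sum is padded with zero modes. *)
Lemma sum_separable_CD xi Q (T : finType) (S : {set T})
    (X : T -> 'I_d -> R -> R) u :
  (0 < d)%N -> (#|S| <= Q)%N ->
  (forall t k, exists c : 'I_(n k) -> R,
     forall s, X t k s = \sum_(I < n k) c I * N k (xi k) I s) ->
  (forall x, box lo hi x ->
     u x = \sum_(t in S) \prod_(k < d) X t k (x ord0 k)) ->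
  CD lo hi N xi Q u.
Proof.
move=> d0 SQ XN uX.
pose Y q k s := if insub q is Some i then X (@enum_val T [in S] i) k s else 0.
exists Y.
  move=> q k; rewrite /Y; case: insub => [i|]; last first.
    by exists (fun=> 0) => s _; rewrite big1 // => I _; rewrite mul0r.
  by have [c cX] := XN (enum_val i) k; exists c => s _.
move=> x xbox; rewrite uX // big_enum_val.
pose F q := \prod_(k < d) Y q k (x ord0 k).
rewrite [RHS](bigID (fun q : 'I_Q => (q < #|S|)%N)) /=.
rewrite -(big_ord_widen Q F) // [X in _ + X]big1 ?addr0.
  by apply: eq_bigr => i _; apply: eq_bigr => k _; rewrite /Y valK.
(* A padding mode vanishes because its product has at least one factor, which is where [0 < d]
   enters. *)
by move=> q qS; rewrite (bigD1 (Ordinal d0)) //= /Y insubN // mul0r.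
Qed.

(* A tensor is the sum of its fibres in a fixed direction [k0], and each fibre
   is a single mode: all directions but [k0] carry one shape function. *)
Lemma FEM_sub_CD xi Q (k0 : 'I_d) :
  (forall k, 0 < n k)%N -> (\prod_(k | k != k0) n k <= Q)%N ->
  FEM lo hi N xi `<=` CD lo hi N xi Q.
Proof.
move=> n0 nQ u [c uc].
(* [base] resets the coordinate [k0] to 0, so it labels the fibre through [I]. [S] is the set of
   these labels, with one choice in direction [k0] and [n k] choices in every other direction
   [k]. *)
pose base (I : node n) : node n :=
  [ffun k => if k == k0 then Ordinal (n0 k) else I k].
pose F k (j : 'I_(n k)) := (k == k0) ==> (j == 0 :> nat)%N.
pose S : {set node n} :=
  [set I : node n | I \in family F]%SET.
(* In direction [k0] the mode of the fibre [r] carries all the coefficients of that fibre. *)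
pose X (r : node n) k s :=
  if k == k0 then \sum_(I : node n | base I == r) c I * N k (xi k) (I k) s
  else N k (xi k) (r k) s.
apply: (sum_separable_CD xi Q _ S X) => [||r k|x xbox].
- exact: leq_ltn_trans (ltn_ord k0).
- rewrite cardsE (card_family F) foldrE big_image /=.
  apply: leq_trans nQ; rewrite (bigD1 k0) //=.
  rewrite (eq_card (B := pred1 (Ordinal (n0 k0)))) ?card1 ?mul1n; last first.
    by move=> j; rewrite unfold_in /F eqxx /= inE -val_eqE.
  apply: leq_prod => k /negPf kk0.
  by apply: leq_trans (max_card _) _; rewrite card_ord.
- rewrite /X; case: (boolP (k == k0)) => kk0.
    exists (fun j => \sum_(I : node n | (base I == r) && (I k == j)) c I) => s.
    rewrite (partition_big (fun I : node n => I k) predT) //=.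
    apply: eq_bigr => j _; rewrite mulr_suml.
    by apply: eq_bigr => I /andP[_ /eqP ->].
  exists (fun j => (j == r k)%:R) => s.
  rewrite (bigD1 (r k)) //= eqxx mul1r big1 ?addr0 // => j /negPf ->.
  by rewrite mul0r.
- rewrite uc // (partition_big base [in S]) /=; last first.
    move=> I _; rewrite finset.in_set; apply/familyP => k.
    by rewrite unfold_in ffunE /F; case: (k == k0).
  apply: eq_bigr => r _; rewrite (bigD1 k0) //= {1}/X eqxx mulr_suml.
  apply: eq_bigr => I /eqP <-; rewrite -mulrA /product_shape; congr (_ * _).
  rewrite (bigD1 k0) //=; congr (_ * _); apply: eq_bigr => k /negPf kk0.
  by rewrite /X kk0 ffunE kk0.
Qed.

Lemma FEM_sub_HiDeNN_PGD xi Q :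
  (forall k, 0 < n k)%N -> enough_modes n Q ->
  regular_grid lo hi xi -> FEM lo hi N xi `<=` HiDeNN_PGD lo hi N Q.
Proof.
move=> n0 /enough_modes_fibre[k0 k0Q] gxi u uFEM; exists xi => //.
exact: FEM_sub_CD k0Q _ uFEM.
Qed.

End approximation_sets.

Theorem mainTheorem3 (R : realType) (d : nat) (hd : d = 2%N \/ d = 3%N)
  (lo hi : 'rV[R]_d) (hbox : forall k, lo ord0 k < hi ord0 k)
  (L : diff_op R d)
  (a : ('rV[R]_d -> R) -> ('rV[R]_d -> R) -> R) (b : 'rV[R]_d -> R)
  (haL : form_of_operator (box lo hi) L a)
  (ha_bilinear : bilinear_on_H10 (box lo hi) a)
  (ha_sym : symmetric_on_H10 (box lo hi) a)
  (ha_pos : positive_definite_on_H10 (box lo hi) a)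
  (hb : source_term (box lo hi) b)
  (n : 'I_d -> nat) (hn : forall k, (2 <= n k)%N)
  (N : shape_family n)
  (hN : forall k, fe_shape_1d (lo ord0 k) (hi ord0 k) (N k))
  (xibar : grid_positions n) (hxibar : regular_grid lo hi xibar)
  (M : mesh_family n) (hM : is_fe_mesh_family lo hi N M)
  (net : network R d) (hnet : HiDeNN lo hi M `<=` NN lo hi net)
  (hCD_H10 : forall Q,
     zero_trace (box lo hi) (CD lo hi N xibar Q) `<=` H10 (box lo hi))
  (hFEM_H10 :
     zero_trace (box lo hi) (FEM lo hi N xibar) `<=` H10 (box lo hi))
  (hPGD_H10 : forall Q,
     zero_trace (box lo hi) (HiDeNN_PGD lo hi N Q) `<=` H10 (box lo hi))
  (hHiDeNN_H10 :
     zero_trace (box lo hi) (HiDeNN lo hi M) `<=` H10 (box lo hi))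
  (hNN_H10 :
     zero_trace (box lo hi) (NN lo hi net) `<=` H10 (box lo hi))
  (uFEM uHiDeNN uNN uexact : 'rV[R]_d -> R)
  (hFEM : is_minimizer (energy (box lo hi) a b)
     (zero_trace (box lo hi) (FEM lo hi N xibar)) uFEM)
  (hHiDeNN : is_minimizer (energy (box lo hi) a b)
     (zero_trace (box lo hi) (HiDeNN lo hi M)) uHiDeNN)
  (hNN : is_minimizer (energy (box lo hi) a b)
     (zero_trace (box lo hi) (NN lo hi net)) uNN)
  (hexact : is_minimizer (energy (box lo hi) a b) (H10 (box lo hi)) uexact) :
  (forall (Q : nat) (uCD : 'rV[R]_d -> R),
     is_minimizer (energy (box lo hi) a b)
       (zero_trace (box lo hi) (CD lo hi N xibar Q)) uCD ->
     [/\ energy_norm a (uCD \- uexact) >= energy_norm a (uFEM \- uexact),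
         energy_norm a (uFEM \- uexact) >= energy_norm a (uHiDeNN \- uexact) &
         energy_norm a (uHiDeNN \- uexact) >= energy_norm a (uNN \- uexact)]) /\
  (forall (Q : nat) (uCD uPGD : 'rV[R]_d -> R),
     enough_modes n Q ->
     is_minimizer (energy (box lo hi) a b)
       (zero_trace (box lo hi) (CD lo hi N xibar Q)) uCD ->
     is_minimizer (energy (box lo hi) a b)
       (zero_trace (box lo hi) (HiDeNN_PGD lo hi N Q)) uPGD ->
     [/\ energy_norm a (uCD \- uexact) >= energy_norm a (uFEM \- uexact),
         energy_norm a (uFEM \- uexact) >= energy_norm a (uPGD \- uexact),
         energy_norm a (uPGD \- uexact) >= energy_norm a (uHiDeNN \- uexact) &
         energy_norm a (uHiDeNN \- uexact) >= energy_norm a (uNN \- uexact)]).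
Proof.
have n0 k : (0 < n k)%N by exact: ltnW.
have err_le S T u v :
    S `<=` T -> zero_trace (box lo hi) T `<=` H10 (box lo hi) ->
    is_minimizer (energy (box lo hi) a b) (zero_trace (box lo hi) S) u ->
    is_minimizer (energy (box lo hi) a b) (zero_trace (box lo hi) T) v ->
    energy_norm a (v \- uexact) <= energy_norm a (u \- uexact).
  move=> ST TH; apply: (energy_norm_minimizer_le lo hi a b) => //.
  exact: zero_trace_sub.
(* The last inequality of both chains. *)
have NN_le := err_le _ _ _ _ hnet hNN_H10 hHiDeNN hNN.
split=> [Q uCD minCD|Q uCD uPGD nQ minCD minPGD]; split=> //.
- exact: err_le (CD_sub_FEM lo hi n N xibar Q) hFEM_H10 minCD hFEM.
- have sub := FEM_sub_HiDeNN lo hi n N M xibar hM hxibar.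
  exact: err_le sub hHiDeNN_H10 hFEM hHiDeNN.
- exact: err_le (CD_sub_FEM lo hi n N xibar Q) hFEM_H10 minCD hFEM.
- have sub := FEM_sub_HiDeNN_PGD lo hi n N xibar Q n0 nQ hxibar.
  exact: err_le sub (hPGD_H10 Q) hFEM minPGD.
- have sub := HiDeNN_PGD_sub_HiDeNN lo hi n N M Q hM.
  exact: err_le sub hHiDeNN_H10 minPGD hHiDeNN.
Qed.
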